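(* Let $S\subseteq \mathbb{Z}^{+}$ be a set with $$\lim_{x\to+\infty}\frac{|S(x)|}{x/\log x}=+\infty,$$ where $S(x)=\{a\le x:\ a\in S\}$. Then, for any $n\in\mathbb{Z}^+$, the set $\mathcal{A}_n=\{\pi(kn):\ k\in\mathbb{Z}^+\}$ contains infinitely many elements of $S$.
   Context: $\mathbb{Z}^+=\{1,2,3,\ldots\}$. For $x\ge 0$, $\pi(x)$ denotes the number of primes not exceeding $x$. $\log$ is the natural logarithm, and $|\cdot|$ denotes the cardinality of a finite set. *)

(* Defs.v *)
From mathcomp Require Import all_boot all_order all_algebra finmap.
From mathcomp Require Import all_classical all_reals all_analysis.

Set Implicit Arguments.
Unset Strict Implicit.
Unset Printing Implicit Defensive.

Import Order.TTheory GRing.Theory Num.Theory.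
Import numFieldNormedType.Exports.

Local Open Scope classical_set_scope.
Local Open Scope ring_scope.

Definition Zplus : set nat := [set k | (0 < k)%N].

Definition upto {R : realType} (S : set nat) (x : R) : set nat :=
  [set a | S a /\ a%:R <= x].

(* [fset_set] returns the empty set on infinite sets, so its use below to take
   cardinalities relies on this finiteness. *)
Lemma finite_upto {R : realType} (S : set nat) (x : R) : finite_set (upto S x).
Proof.
apply: (@sub_finite_set _ _ `I_(Num.truncn x).+1); last exact: finite_II.
move=> a [_ ax] /=; rewrite ltnS.
by rewrite -(@natrK R a) le_truncn.
Qed.

Definition count_upto {R : realType} (S : set nat) (x : R) : nat :=
  #|` fset_set (upto S x)|%fset.

Definition primepi {R : realType} (x : R) : nat :=
  count_upto [set p | prime p] x.

Definition primepi_multiples (R : realType) (n : nat) : set nat :=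
  [set primepi ((k * n)%:R : R) | k in Zplus].

(* Main.v *)
Require Import Defs.
From mathcomp Require Import all_boot all_order all_algebra finmap.
From mathcomp Require Import all_classical all_reals all_analysis.
From mathcomp Require Import zify ring lra.

(** Say that m is skipped when it is not of the form pi(k n). If m = pi(p) with p
    prime is skipped, then no multiple of n lies between p and the next prime, so
    p + h is prime for some 0 < h < n ([skipped_value]). A sieve bounds the number
    of such p up to N by C N / (log N)^2 ([prime_pairs_le]), whereas Chebyshev's
    lower bound gives pi(N) >= c N / log N ([chebyshev_lower]). Hence among the
    integers up to x = pi(N) at most O(N / (log N)^2) = O(x / log x) are skipped.
    As S has many more elements than that up to x, infinitely many of them are
    not skipped. It is enough to let N run through the powers N = 2 ^ (16 k),
    which keeps logarithms out of the arithmetic.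

    The sieve ([pair_sieve]) is Selberg's upper bound, in a dual form. To each
    prime p not dividing 2 h is attached the p-periodic function that is 1 unless
    p divides n (n + h), and whose value there makes its mean zero. The products
    of these functions over the primes dividing d, for d <= z squarefree, are
    nearly orthogonal on an interval of length N, by the Chinese remainder
    theorem ([mode_correlation]). The combination of them with coefficients
    2 ^ omega(d) / d takes the constant value W = sum of the 2 ^ omega(d) / d at
    all n with n (n + h) free of primes up to z, and has mean square about W.
    So there are at most N / W such n, up to an error polynomial in z.

    To bound W below by c (log z)^2 ([sieve_mass_ge]), consider the square of the
    sum of 1 / a over a <= sqrt z coprime to 2 h. Removing from a its square
    factor, and from a pair its greatest common divisor, loses only constant
    factors, as the sum of 1 / s^2 converges. What remains is a sum of 1 / (u v)
    over pairs whose product is a squarefree d <= z, each d arising from at most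
    2 ^ omega(d) pairs. *)

Set Implicit Arguments.
Unset Strict Implicit.
Unset Printing Implicit Defensive.

Import Order.TTheory GRing.Theory Num.Theory.
Import numFieldNormedType.Exports.

Local Open Scope ring_scope.

(** * Sums of periodic functions *)

Section PeriodicSums.
Variable F : realFieldType.

Definition periodic (m : nat) (f : nat -> F) := forall n, f (n %% m)%N = f n.

Lemma periodic_dvd m m' f : (m %| m')%N -> periodic m f -> periodic m' f.
Proof. by move=> mm' fP n; rewrite -fP modn_dvdm// fP. Qed.

Lemma periodic_prod (s : seq nat) (f : nat -> nat -> F) :
  (forall p, p \in s -> periodic p (f p)) ->
  periodic (\prod_(p <- s) p)%N (fun n => \prod_(p <- s) f p n).
Proof.
move=> fP n; apply: eq_big_seq => p ps.
by rewrite (periodic_dvd _ (fP p ps))// (big_rem p ps)/= dvdn_mulr.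
Qed.

(** The Chinese remainder theorem makes the two residues of n independent. *)
Lemma sum_periodic_coprime a b f g : (0 < a)%N -> (0 < b)%N -> coprime a b ->
  periodic a f -> periodic b g ->
  \sum_(n < (a * b)%N) f n * g n = (\sum_(n < a) f n) * (\sum_(n < b) g n).
Proof.
move=> a0 b0 cab fP gP; rewrite big_distrlr pair_big /=.
have lt_ab (ij : 'I_a * 'I_b) : (chinese a b ij.1 ij.2 %% (a * b) < a * b)%N.
  by rewrite ltn_mod muln_gt0 a0.
pose crt ij := Ordinal (lt_ab ij).
have crt_a ij : (crt ij %% a)%N = ij.1 :> nat.
  by rewrite /= modn_dvdm ?dvdn_mulr// chinese_modl// modn_small.
have crt_b ij : (crt ij %% b)%N = ij.2 :> nat.
  by rewrite /= modn_dvdm ?dvdn_mull// chinese_modr// modn_small.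
have crt_inj : injective crt.
  move=> ij ij' eq_crt; rewrite [ij]surjective_pairing [ij']surjective_pairing.
  by congr pair; apply: val_inj => /=; rewrite -?crt_a -?crt_b eq_crt.
have crt_bij : bijective crt by apply: inj_card_bij; rewrite // card_prod !card_ord.
rewrite (reindex crt) /=; last exact: onW_bij.
by apply: eq_bigr => ij _; rewrite -[f _]fP -[g _]gP crt_a crt_b.
Qed.

Lemma sum_prod_periodic (s : seq nat) (f : nat -> nat -> F) :
  uniq s -> all prime s -> (forall p, p \in s -> periodic p (f p)) ->
  \sum_(n < (\prod_(p <- s) p)%N) \prod_(p <- s) f p n
  = \prod_(p <- s) \sum_(n < p) f p n.
Proof.
elim: s => [|p s IHs] /=; first by rewrite !big_nil big_ord1 big_nil.
case/andP=> ps us /andP[pr_p pr_s] fP.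
have fPs q : q \in s -> periodic q (f q) by move=> qs; apply: fP; rewrite inE qs orbT.
rewrite !big_cons -IHs//.
rewrite -(@sum_periodic_coprime _ _ (f p) (fun n => \prod_(q <- s) f q n)).
- by apply: eq_bigr => n _; rewrite big_cons.
- exact: prime_gt0.
- by rewrite big_seq prodn_cond_gt0// => q /(allP pr_s)/prime_gt0.
- rewrite big_seq; elim/big_ind: _ => [|a b ca cb|q qs]; first by rewrite coprimen1.
    by rewrite coprimeMr ca.
  rewrite prime_coprime// dvdn_prime2 ?(allP pr_s _ qs)//.
  by apply: contraNneq ps => ->.
- by apply: fP; rewrite inE eqxx.
- exact: periodic_prod.
Qed.

(** Full periods contribute at most V per term on average; the incomplete last
    one costs at most its length times the sup norm, whatever N is. *)
Lemma sum_periodic_le M f (B V : F) N : (0 < M)%N -> periodic M f -> 0 <= V ->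
  (forall n, `|f n| <= B) -> \sum_(n < M) f n <= M%:R * V ->
  \sum_(n < N) f n <= N%:R * V + M%:R * B.
Proof.
move=> M0 fP V0 fB fV; have B0 : 0 <= B := le_trans (normr_ge0 _) (fB 0).
elim/ltn_ind: N => N IH; have [ltNM | leMN] := ltnP N M.
  apply: (@le_trans _ _ (N%:R * B)).
    rewrite mulr_natl -[N in _ *+ N]card_ord -sumr_const ler_sum// => n _.
    exact: le_trans (ler_norm _) (fB n).
  have : N%:R * B <= M%:R * B by rewrite ler_wpM2r// ler_nat ltnW.
  by move=> le1; rewrite (le_trans le1)// lerDr mulr_ge0.
rewrite -(subnKC leMN) big_split_ord /= natrD mulrDl.
have -> : \sum_(i < N - M) f (M + i)%N = \sum_(i < N - M) f i.
  by apply: eq_bigr => i _; rewrite -fP modnDl fP.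
have := IH (N - M)%N; rewrite ltn_subrL M0 (leq_trans M0 leMN) => /(_ isT).
by move=> le1; rewrite -addrA lerD.
Qed.

End PeriodicSums.

(** * Squarefree numbers *)

Definition squarefree d := (0 < d)%N && all (fun p => logn p d <= 1)%N (primes d).

Lemma squarefreeP d :
  reflect (0 < d /\ forall p, logn p d <= 1)%N (squarefree d).
Proof.
apply: (iffP andP) => -[d0]; last by move=> dP; split=> //; apply/allP.
move=> /allP dP; split=> // p; have [/dP // | ] := boolP (p \in primes d).
by rewrite -logn_gt0 -eqn0Ngt => /eqP ->.
Qed.

Lemma squarefree_gt0 d : squarefree d -> (0 < d)%N.
Proof. by case/andP. Qed.

Lemma squarefree_dvd d e : (e %| d)%N -> squarefree d -> squarefree e.
Proof.
move=> ed /squarefreeP[d0 dP]; apply/squarefreeP; split=> [|p].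
  exact: dvdn_gt0 ed.
exact: leq_trans (dvdn_leq_log p d0 ed) (dP p).
Qed.

Lemma squarefreeM u v :
  coprime u v -> squarefree u -> squarefree v -> squarefree (u * v).
Proof.
move=> cuv /squarefreeP[u0 uP] /squarefreeP[v0 vP].
apply/squarefreeP; split=> [|p]; first by rewrite muln_gt0 u0.
rewrite lognM//; have [p_u | ] := boolP (p \in primes u); last first.
  by rewrite -logn_gt0 -eqn0Ngt => /eqP ->; apply: vP.
suff -> : logn p v = 0%N by rewrite addn0.
apply: logn_coprime; move: p_u; rewrite mem_primes => /and3P[pr_p _ pu].
exact: coprime_dvdl pu cuv.
Qed.

Lemma prod_primes d : squarefree d -> (\prod_(p <- primes d) p)%N = d.
Proof.
move=> /squarefreeP[d0 dP]; rewrite [RHS]prod_prime_decomp// prime_decompE big_map.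
apply: eq_big_seq => p; rewrite -logn_gt0 => p_d /=.
by rewrite (_ : logn p d = 1)%N ?expn1//; apply/eqP; rewrite eqn_leq dP.
Qed.

Lemma squarefree_inj d e :
  squarefree d -> squarefree e -> primes d =i primes e -> d = e.
Proof. by move=> dP eP /eq_primes eq_de; rewrite -[d]prod_primes// eq_de prod_primes. Qed.

Lemma square_squarefree a : (0 < a)%N ->
  exists s d, a = (s ^ 2 * d)%N /\ squarefree d.
Proof.
elim/ltn_ind: a => a IH a0.
have [ | /allPn[p]] := boolP (all (fun p => logn p a <= 1)%N (primes a)).
  by move=> aP; exists 1%N, a; rewrite mul1n /squarefree a0.
rewrite mem_primes => /and3P[pr_p _ _]; rewrite -ltnNge => lt1.
have p2a : (p ^ 2 %| a)%N by rewrite pfactor_dvdn.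
have p2_gt1 : (1 < p ^ 2)%N by rewrite (ltn_exp2l 0) ?prime_gt1.
have [||s [d [eq_a dP]]] := IH (a %/ p ^ 2)%N.
- by rewrite ltn_Pdiv.
- by rewrite divn_gt0 ?(dvdn_leq a0 p2a)// (ltn_trans _ p2_gt1).
by exists (p * s)%N, d; split=> //; rewrite expnMn -mulnA -eq_a mulnC divnK.
Qed.

(** A factorization of d is determined by the set of primes of its first
    factor, because that factor is squarefree too. *)
Lemma card_factorizations y d : squarefree d ->
  (#|[pred uv : 'I_y * 'I_y | uv.1 * uv.2 == d]| <= 2 ^ size (primes d))%N.
Proof.
move=> dP; have d0 := squarefree_gt0 dP.
pose f (uv : 'I_y * 'I_y) := map_tuple (fun p => p %| uv.1)%N (in_tuple (primes d)).
suff inj_f : {in [pred uv : 'I_y * 'I_y | (uv.1 * uv.2)%N == d] &, injective f}.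
  by rewrite (leq_trans (leq_card_in f _ inj_f))// card_tuple card_bool.
move=> [u v] [u' v']; rewrite !inE /= => /eqP eq_d /eqP eq_d' /(congr1 val)/= eq_f.
have ud : (u %| d)%N by rewrite -eq_d dvdn_mulr.
have ud' : (u' %| d)%N by rewrite -eq_d' dvdn_mulr.
have eq_u : u = u' :> nat.
  apply: squarefree_inj; [exact: squarefree_dvd dP .. | move=> p].
  have u0 := dvdn_gt0 d0 ud; have u0' := dvdn_gt0 d0 ud'.
  rewrite !mem_primes u0 u0'/=; case pr_p: (prime p) => //=.
  have [p_d | ] := boolP (p \in primes d); first by move/eq_in_map: eq_f; exact.
  rewrite mem_primes pr_p d0/= => pNd.
  apply/idP/idP => pu; case/negP: pNd; exact: dvdn_trans pu _.
congr pair; apply: val_inj => //=; apply/eqP.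
by rewrite -(eqn_pmul2l (dvdn_gt0 d0 ud)) [in X in _ == X]eq_u eq_d eq_d'.
Qed.

(** * A sieve for pairs n, n + h *)

Section PairSieve.
Variables (F : realFieldType) (h : nat).

Definition sieve_modulus d := squarefree d && coprime d (2 * h).

(** The value 1 - p / 2 is the one for which [wave p] has mean zero over a period,
    n (n + h) having two roots modulo a prime p that does not divide 2 h. *)
Definition wave p n : F := if (p %| n * (n + h))%N then 1 - p%:R / 2 else 1.

Definition mode d n : F := \prod_(p <- primes d) wave p n.

(** For a modulus d of the sieve, this is the density of the integers n such that
    d divides n (n + h). *)
Definition weight d : F := \prod_(p <- primes d) (2 / p%:R).

Definition sieve_mass z : F := \sum_(d < z.+1 | sieve_modulus d) weight d.

Lemma periodic_wave p : periodic p (wave p).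
Proof. by move=> n; rewrite /wave /dvdn -modnMm modn_mod modnDml modnMm. Qed.

(** The roots of n (n + h) modulo p are 0 and - h, which are distinct since p
    does not divide h. *)
Lemma count_roots p : prime p -> coprime p (2 * h) ->
  \sum_(n < p) (p %| n * (n + h))%N%:R = 2 :> F.
Proof.
move=> pr_p; rewrite coprimeMr => /andP[_ cph]; have p0 := prime_gt0 pr_p.
have hp0 : (0 < h %% p)%N.
  by rewrite lt0n; apply: contraTneq cph => /eqP ph; rewrite prime_coprime// negbK.
have lt_root : (p - h %% p < p)%N by rewrite ltn_subrL hp0.
pose r0 := Ordinal p0; pose r1 := Ordinal lt_root.
have r10 : r1 != r0 by rewrite -val_eqE /= subn_eq0 -ltnNge ltn_mod.
have r1_root : (p %| r1 + h)%N.
  rewrite /dvdn -modnDmr /= subnK ?modnn// ltnW// ltn_mod//.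
rewrite (bigD1 r0)//= (bigD1 r1)//= mul0n dvdn0 dvdn_mull// big1 ?addr0 -?natrD//.
move=> n /andP[n0 n1]; rewrite Euclid_dvdM// gtnNdvd//=; last first.
  by rewrite lt0n; apply: contraNneq n0 => n0; apply/eqP/val_inj.
suff /negPf -> : ~~ (p %| n + h)%N by [].
apply: contraNN n1 => n_root; apply/eqP/val_inj.
have : (n + h == r1 + h %[mod p])%N by rewrite (eqP n_root) (eqP r1_root).
by rewrite eqn_modDr !modn_small// => /eqP.
Qed.

Lemma waveE p n : wave p n = 1 - p%:R / 2 * (p %| n * (n + h))%N%:R.
Proof. by rewrite /wave; case: ifP; rewrite ?mulr1 ?mulr0 ?subr0. Qed.

Lemma sum_wave p : prime p -> coprime p (2 * h) -> \sum_(n < p) wave p n = 0.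
Proof.
move=> pr_p cp; under eq_bigr do rewrite waveE.
by rewrite big_split /= sumrN -mulr_sumr count_roots// sumr_const card_ord divfK ?subrr ?pnatr_eq0.
Qed.

Lemma sum_wave_sqr p : prime p -> coprime p (2 * h) ->
  \sum_(n < p) wave p n ^+ 2 <= p%:R * (p%:R / 2).
Proof.
move=> pr_p cp.
have waveE2 n : wave p n ^+ 2 = 1 + (p%:R ^+ 2 / 4 - p%:R) * (p %| n * (n + h))%N%:R.
  by rewrite waveE; case: (p %| _)%N; rewrite ?mulr1 ?mulr0; field.
under eq_bigr do rewrite waveE2.
rewrite big_split /= -mulr_sumr count_roots// sumr_const card_ord.
have : 0 <= p%:R :> F by []; nra.
Qed.

Lemma norm_wave_le p n : prime p -> `|wave p n| <= p%:R.
Proof.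
move=> pr_p; have : 2 <= p%:R :> F by rewrite ler_nat prime_gt1.
by rewrite /wave; case: ifP => _ p2; rewrite ler_norml; lra.
Qed.

Lemma leq_prod_primes m : (0 < m)%N -> (\prod_(p <- primes m) p <= m)%N.
Proof.
move=> m0; rewrite [X in (_ <= X)%N]prod_prime_decomp// prime_decompE big_map /=.
rewrite big_seq [X in (_ <= X)%N]big_seq; apply: leq_prod => p p_m.
have /and3P[pr_p _ _] : [&& prime p, (0 < m)%N & (p %| m)%N] by rewrite -mem_primes.
by rewrite -{1}[p]expn1 leq_exp2l ?logn_gt0// prime_gt1.
Qed.

Lemma norm_mode_le d n : (0 < d)%N -> `|mode d n| <= d%:R.
Proof.
move=> d0; rewrite (le_trans _ (_ : (\prod_(p <- primes d) p)%N%:R <= _))//; last first.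
  by rewrite ler_nat leq_prod_primes.
rewrite normr_prod natr_prod big_seq [leRHS]big_seq ler_prod// => p.
by rewrite mem_primes => /and3P[pr_p _ _]; rewrite normr_ge0 norm_wave_le.
Qed.

Lemma weight_gt0 d : 0 < weight d.
Proof.
rewrite /weight big_seq; apply: prodr_gt0 => p.
by rewrite mem_primes => /and3P[pr_p _ _]; rewrite divr_gt0// ltr0n prime_gt0.
Qed.

(** Modes of distinct moduli are orthogonal over a full period, because some
    prime divides exactly one of the moduli and its wave has mean zero. When
    the moduli agree, each prime p contributes the mean square of its wave,
    which is at most p / 2. The error is the period times the sup norm. *)
Lemma mode_correlation d d' N : sieve_modulus d -> sieve_modulus d' ->
  \sum_(n < N) mode d n * mode d' n
    <= N%:R * ((d == d')%:R / weight d) + ((d * d') ^ 2)%N%:R.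
Proof.
move=> /andP[dP d_2h] /andP[dP' d_2h'].
have [d0 d0'] := (squarefree_gt0 dP, squarefree_gt0 dP').
pose s := primes (d * d'); pose M := (\prod_(p <- s) p)%N.
have s_prime p : p \in s -> prime p by rewrite mem_primes => /and3P[].
have s_coprime p : p \in s -> coprime p (2 * h).
  rewrite primesM// !mem_primes => /orP[] /and3P[_ _ pd].
    exact: coprime_dvdl pd d_2h.
  exact: coprime_dvdl pd d_2h'.
pose f p n := (if p \in primes d then wave p n else 1)
              * (if p \in primes d' then wave p n else 1).
(* Both modes become products over the same list of primes. *)
have restrict e (g : nat -> F) : {subset primes e <= s} ->
    \prod_(p <- primes e) g p = \prod_(p <- s) if p \in primes e then g p else 1.
  move=> es; rewrite -big_mkcond -[RHS]big_filter; apply: perm_big.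
  apply: uniq_perm; rewrite ?filter_uniq ?primes_uniq// => p.
  by rewrite mem_filter; case: (boolP (p \in primes e)) => //= /es ->.
have sub_d : {subset primes d <= s} by move=> p p_d; rewrite primesM// p_d.
have sub_d' : {subset primes d' <= s} by move=> p p_d; rewrite primesM// p_d orbT.
have modeE n : mode d n * mode d' n = \prod_(p <- s) f p n.
  by rewrite /mode (restrict d)// (restrict d')// big_split.
have f_per p : p \in s -> periodic p (f p).
  by move=> _ n; rewrite /f periodic_wave.
have M0 : (0 < M)%N by rewrite /M big_seq prodn_cond_gt0// => p /s_prime/prime_gt0.
have M_le : (M <= d * d')%N by rewrite leq_prod_primes// muln_gt0 d0.
under eq_bigr do rewrite modeE.
apply: (@le_trans _ _ (N%:R * ((d == d')%:R / weight d) + M%:R * (d * d')%N%:R)).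
  apply: (@sum_periodic_le _ M (fun n => \prod_(p <- s) f p n)) => //.
  - exact: periodic_prod.
  - by rewrite divr_ge0// ltW// weight_gt0.
  - by move=> n; rewrite -modeE normrM natrM ler_pM// norm_mode_le.
  rewrite sum_prod_periodic ?primes_uniq//; last exact/allP.
  have [eq_dd' | d_neq] := eqVneq d d'; last first.
    have /allPn[p p_s pP] : ~~ all (fun p => (p \in primes d) == (p \in primes d')) s.
      apply: contraNN d_neq => /allP eq_dd'; apply/eqP/squarefree_inj => // p.
      have [p_s | pNs] := boolP (p \in s); first exact/eqP/eq_dd'.
      by rewrite (contraNF (@sub_d p) pNs) (contraNF (@sub_d' p) pNs).
    rewrite (big_rem p p_s)/= (_ : \sum_(n < p) f p n = 0) ?mul0r ?mulr0 ?mul0r//.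
    rewrite -[RHS](@sum_wave p) ?s_prime ?s_coprime//; apply: eq_bigr => n _.
    by rewrite /f; move: pP; do 2!case: (_ \in _) => //=; rewrite ?mul1r ?mulr1.
  rewrite mul1r /weight -prodfV /M natr_prod.
  rewrite (restrict d (fun p => (2 / p%:R)^-1))//.
  rewrite -big_split big_seq [leRHS]big_seq ler_prod//= => p p_s.
  have p_d : p \in primes d by move: p_s; rewrite primesM// -eq_dd' orbb.
  have p_d' : p \in primes d' by rewrite -eq_dd'.
  rewrite p_d invf_div; apply/andP; split.
    by apply: sumr_ge0 => n _; rewrite /f p_d p_d' -expr2 sqr_ge0.
  rewrite (le_trans _ (sum_wave_sqr (s_prime _ p_s) (s_coprime _ p_s)))//.
  by rewrite ler_sum// => n _; rewrite /f p_d p_d' expr2.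
by rewrite lerD2l natrX expr2 -natrM -natrM ler_nat leq_mul2r M_le orbT.
Qed.

Lemma sieve_mass_ge1 z : (0 < z)%N -> 1 <= sieve_mass z.
Proof.
move=> z0; pose one := Ordinal (z0 : 1 < z.+1)%N.
have one_mod : sieve_modulus one by rewrite /sieve_modulus coprime1n.
rewrite /sieve_mass (bigD1 one one_mod) /= {1}/weight big_nil lerDl sumr_ge0// => d _.
exact/ltW/weight_gt0.
Qed.

(** Let g be the sum over d of [weight d * mode d]. On the integers that survive
    the sieve every mode is 1, so that g is equal to the sieve mass W; hence
    #|A| W^2 is at most the sum of g^2 over the interval. By near-orthogonality
    of the modes this sum is at most N W + W^2 z^4. The error z^4 is so small
    compared to N, for z a small power of N, that no care is needed with it. *)
Lemma pair_sieve N z (A : pred nat) : (0 < z)%N ->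
  (forall n p, A n -> prime p -> (p <= z)%N -> ~~ (p %| n * (n + h))%N) ->
  #|[pred n : 'I_N | A n]|%:R <= N%:R / sieve_mass z + (z ^ 4)%N%:R :> F.
Proof.
move=> z0 A_sifted; set W := sieve_mass z.
have W0 : 0 < W := lt_le_trans ltr01 (sieve_mass_ge1 z0).
pose g n := \sum_(d < z.+1 | sieve_modulus d) weight d * mode d n.
have gA n : A n -> g n = W.
  move=> An; apply: eq_bigr => d _; rewrite /mode big_seq big1 ?mulr1// => p.
  rewrite mem_primes => /and3P[pr_p d0 pd].
  rewrite /wave (negPf (A_sifted _ _ An pr_p _))//.
  by rewrite (leq_trans (dvdn_leq d0 pd))// -ltnS.
have lower : #|[pred n : 'I_N | A n]|%:R * W ^+ 2 <= \sum_(n < N) g n ^+ 2.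
  rewrite mulr_natl -sumr_const big_mkcond ler_sum//= => n _.
  by case: ifP => [/gA -> | _]; rewrite ?sqr_ge0.
have upper : \sum_(n < N) g n ^+ 2 <= N%:R * W + W ^+ 2 * (z ^ 4)%N%:R.
  pose rhs (d d' : nat) : F := N%:R * (weight d' * (d == d')%:R) + weight d * weight d' * (z ^ 4)%N%:R.
  apply: (@le_trans _ _ (\sum_(d < z.+1 | sieve_modulus d)
                          \sum_(d' < z.+1 | sieve_modulus d') rhs d d')).
    under eq_bigr do rewrite expr2 big_distrlr /=.
    rewrite exchange_big /=; apply: ler_sum => d d_mod.
    rewrite exchange_big /=; apply: ler_sum => d' d_mod'.
    under eq_bigr do rewrite mulrACA.
    rewrite -mulr_sumr; have w0 := weight_gt0 d; have w0' := weight_gt0 d'.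
    apply: (le_trans (ler_wpM2l _ (mode_correlation N d_mod d_mod'))).
      by rewrite mulr_ge0// ltW.
    rewrite mulrDr lerD// /rhs; last first.
      apply: ler_wpM2l; first by rewrite mulr_ge0 ?ltW.
      rewrite ler_nat -[4%N]/(2 * 2)%N expnM.
      by rewrite leq_exp2r// -mulnn leq_mul// -ltnS.
    rewrite le_eqVlt; apply/orP; left; apply/eqP.
    by rewrite eq_sym; field; rewrite gt_eqF.
  rewrite /rhs; under eq_bigr do rewrite big_split /= -!mulr_sumr -mulr_suml -mulr_sumr.
  rewrite big_split /= -mulr_sumr -mulr_suml -mulr_suml -expr2 lerD// ler_wpM2l//.
  rewrite ler_sum// => d d_mod; rewrite (bigD1 d)//= eqxx mulr1 big1 ?addr0// => d' /andP[_].
  by rewrite eq_sym -val_eqE => /negPf ->; rewrite mulr0.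
rewrite -(ler_pM2r (exprn_gt0 2 W0)) (le_trans lower)// (le_trans upper)//.
by rewrite le_eqVlt; apply/orP; left; apply/eqP; field; rewrite gt_eqF.
Qed.

End PairSieve.

(** * Lower bound for the sieve mass *)

Section SieveMass.
Variables (F : realFieldType) (h : nat).

Lemma ler_sum_inj (I J : finType) (f : I -> J) (P : pred I) (Q : pred J) (G : J -> F) :
  {in P &, injective f} -> (forall i, P i -> Q (f i)) -> (forall j, 0 <= G j) ->
  \sum_(i | P i) G (f i) <= \sum_(j | Q j) G j.
Proof.
move=> f_inj PQ G0; rewrite -(@big_imset _ _ _ _ _ f P)//.
rewrite [leRHS]big_mkcond [leLHS]big_mkcond; apply: ler_sum => j _.
case: ifP => [/imsetP[i /PQ Qi ->] | _]; first by rewrite Qi.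
by case: ifP.
Qed.

(** The term s = 0 is 0; the others telescope against 2 - 1 / y. *)
Lemma sum_inv_sqr_le y : \sum_(s < y.+1) (s ^ 2)%N%:R^-1 <= 2 :> F.
Proof.
suff bound : \sum_(s < y.+2) (s ^ 2)%N%:R^-1 <= 2 - y.+1%:R^-1 :> F.
  apply: le_trans (_ : 2 - y.+1%:R^-1 <= 2); last by rewrite gerDl oppr_le0 invr_ge0.
  by apply: le_trans bound; rewrite [leRHS]big_ord_recr lerDl invr_ge0.
elim: y => [|y IH].
  by rewrite !big_ord_recl big_ord0 /= invr0 invr1 /bump /=; lra.
rewrite big_ord_recr /= (le_trans (lerD IH (lexx _)))// natrX.
have y0 : 0 < y.+1%:R :> F by rewrite ltr0n.
rewrite -[y.+2%:R]natr1; move: y.+1%:R y0 => t t0.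
rewrite -subr_ge0 [X in 0 <= X](_ : _ = t^-1 * ((t + 1) ^+ 2)^-1); last first.
  by field; rewrite !gt_eqF// addr_gt0.
by rewrite mulr_ge0// invr_ge0 ?sqr_ge0// ltW.
Qed.

Lemma weightE d : squarefree d -> weight F d = 2 ^+ size (primes d) / d%:R.
Proof.
move=> dP; rewrite /weight big_split /= big_const_seq count_predT iter_mulr_1.
by rewrite prodfV -natr_prod prod_primes.
Qed.

Lemma coprime_divn_gcd a b : (0 < a)%N -> coprime (a %/ gcdn a b) (b %/ gcdn a b).
Proof.
move=> a0; have g0 : (0 < gcdn a b)%N by rewrite gcdn_gt0 a0.
by rewrite /coprime -(eqn_pmul2r g0) muln_gcdl !divnK ?dvdn_gcdl ?dvdn_gcdr ?mul1n.
Qed.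

Definition coprime_harmonic y : F := \sum_(a < y.+1 | coprime a (2 * h)) a%:R^-1.

Definition modulus_harmonic y : F := \sum_(d < y.+1 | sieve_modulus h d) d%:R^-1.

(** Write a = s^2 d with d squarefree: the sum over the square factors costs only
    the constant bounding the sum of 1 / s^2. *)
Lemma coprime_harmonic_le y : coprime_harmonic y <= 2 * modulus_harmonic y.
Proof.
apply: le_trans (_ : (\sum_(s < y.+1) (s ^ 2)%N%:R^-1) * modulus_harmonic y <= _); last first.
  by rewrite ler_wpM2r ?sum_inv_sqr_le// sumr_ge0// => d _; rewrite invr_ge0.
(* The default pair (0, 0) is for the indices a that do not enter the sum. *)
have /fin_all_exists[f fP] (a : 'I_y.+1) : exists sd : 'I_y.+1 * 'I_y.+1,
    coprime a (2 * h) -> a = (sd.1 ^ 2 * sd.2)%N :> nat /\ sieve_modulus h sd.2.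
  have [a_2h | _] := boolP (coprime a (2 * h)); last by exists (ord0, ord0).
  have a0 : (0 < a)%N.
    rewrite lt0n; apply: contraTneq a_2h => ->.
    by rewrite /coprime gcd0n; case: (h) => // n; rewrite mulnS.
  have [s [d [eq_a dP]]] := square_squarefree a0; have d0 := squarefree_gt0 dP.
  have s_a : (s < y.+1)%N.
    apply: leq_ltn_trans (ltn_ord a); rewrite eq_a -mulnn -mulnA leq_pmulr// muln_gt0 d0 andbT.
    by move: a0; rewrite eq_a muln_gt0 expn_gt0 orbF => /andP[].
  have d_a : (d < y.+1)%N.
    apply: leq_ltn_trans (ltn_ord a); rewrite eq_a leq_pmull//.
    by move: a0; rewrite eq_a muln_gt0 => /andP[].
  exists (Ordinal s_a, Ordinal d_a) => _ /=; split=> //; rewrite /sieve_modulus dP.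
  by apply: coprime_dvdl a_2h; rewrite eq_a dvdn_mull.
rewrite big_distrlr pair_big /=.
apply: le_trans (ler_sum_inj (f := f) (P := fun a => coprime a (2 * h)) _ _ _).
- apply: ler_sum => a /fP[eq_a _].
  by rewrite {1}eq_a natrM invfM.
- by move=> a b /fP[eq_a _] /fP[eq_b _] eq_f; apply: val_inj; rewrite /= eq_a eq_b eq_f.
- by move=> a /fP[].
- by move=> sd; rewrite mulr_ge0 ?invr_ge0.
Qed.

(** Write a = g u and b = g v with g the gcd of a and b: then u v is again a
    modulus, and the sum of 1 / g^2 costs only a constant. *)
Lemma modulus_harmonic_sqr_le y : modulus_harmonic y ^+ 2 <=
  2 * \sum_(uv : 'I_y.+1 * 'I_y.+1 | sieve_modulus h (uv.1 * uv.2)) (uv.1 * uv.2)%N%:R^-1.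
Proof.
set T := \sum_(uv | _) _.
apply: le_trans (_ : (\sum_(s < y.+1) (s ^ 2)%N%:R^-1) * T <= _); last first.
  by rewrite ler_wpM2r ?sum_inv_sqr_le// sumr_ge0// => uv _; rewrite invr_ge0.
rewrite expr2 /T !big_distrlr !pair_big /=.
pose f (ab : 'I_y.+1 * 'I_y.+1) : 'I_y.+1 * ('I_y.+1 * 'I_y.+1) :=
  let g := gcdn ab.1 ab.2 in (inord g, (inord (ab.1 %/ g), inord (ab.2 %/ g))).
pose P (ab : 'I_y.+1 * 'I_y.+1) := sieve_modulus h ab.1 && sieve_modulus h ab.2.
have fP ab : P ab -> let: (g, (u, v)) := f ab in
    [/\ ab.1 = (g * u)%N :> nat, ab.2 = (g * v)%N :> nat & sieve_modulus h (u * v)].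
  case: ab => a b /andP[/= /andP[aP a_2h] /andP[bP b_2h]].
  have [a0 b0] := (squarefree_gt0 aP, squarefree_gt0 bP).
  have [ga gb] := (dvdn_gcdl a b, dvdn_gcdr a b).
  have bound m (c : 'I_y.+1) : (0 < c)%N -> (m %| c)%N -> (m < y.+1)%N.
    by move=> c0 mc; exact: leq_ltn_trans (dvdn_leq c0 mc) (ltn_ord c).
  rewrite !inordK ?(bound _ _ a0 ga) ?(bound _ _ a0 (dvdn_div ga)) ?(bound _ _ b0 (dvdn_div gb))//.
  rewrite ![(gcdn a b * _)%N]mulnC !divnK//; split=> //.
  apply/andP; split; last first.
    by rewrite coprimeMl (coprime_dvdl (dvdn_div ga) a_2h) (coprime_dvdl (dvdn_div gb) b_2h).
  apply: squarefreeM (coprime_divn_gcd b a0) _ _.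
    exact: squarefree_dvd (dvdn_div ga) aP.
  exact: squarefree_dvd (dvdn_div gb) bP.
apply: le_trans (ler_sum_inj (f := f) (P := P) _ _ _).
- apply: ler_sum => ab /fP; case: (f ab) => g [u v] /= [-> -> _].
  by rewrite -mulnn !natrM !invfM mulrACA.
- move=> [a b] [a' b'] /fP fab /fP fab' eq_f; move: fab fab'; rewrite -eq_f.
  case: (f _) => g [u v] /= [eq_a eq_b _] [eq_a' eq_b' _].
  by congr pair; apply: val_inj; rewrite /= ?eq_a ?eq_a' ?eq_b ?eq_b'.
- by move=> ab /fP; case: (f ab) => g [u v] /= [].
- by move=> [g [u v]] /=; rewrite mulr_ge0 ?invr_ge0.
Qed.

(** A modulus d is u v in at most 2 ^ omega(d) ways, and [weight d] is exactly
    2 ^ omega(d) / d. *)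
Lemma sum_splittings_le y :
  \sum_(uv : 'I_y.+1 * 'I_y.+1 | sieve_modulus h (uv.1 * uv.2)) (uv.1 * uv.2)%N%:R^-1
    <= sieve_mass F h (y ^ 2).
Proof.
pose I := 'I_y.+1; have bound (uv : I * I) : (uv.1 * uv.2 < (y ^ 2).+1)%N.
  by rewrite ltnS -mulnn leq_mul// -ltnS.
rewrite (partition_big (fun uv => Ordinal (bound uv)) (fun d => sieve_modulus h d))//=.
apply: ler_sum => d /andP[dP _].
rewrite (eq_bigr (fun=> d%:R^-1)); last by move=> uv /andP[_ /eqP <-].
rewrite sumr_const weightE// -[leLHS]mulr_natl ler_wpM2r ?invr_ge0// -natrX ler_nat.
apply: leq_trans (card_factorizations y.+1 dP); apply: subset_leq_card.
by apply/fintype.subsetP => uv; rewrite !inE => /andP[_ /eqP <-].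
Qed.

Lemma coprime_harmonic_sqr_le y : coprime_harmonic y ^+ 2 <= 8 * sieve_mass F h (y ^ 2).
Proof.
have le1 := coprime_harmonic_le y; have le2 := modulus_harmonic_sqr_le y.
have le3 := sum_splittings_le y.
have S0 : 0 <= coprime_harmonic y by apply: sumr_ge0 => a _; rewrite invr_ge0.
nra.
Qed.

Lemma harmonic_pow2_ge m : m%:R / 2 <= \sum_(i < (2 ^ m)%N) i.+1%:R^-1 :> F.
Proof.
elim: m => [|m IH]; first by rewrite mul0r sumr_ge0// => i _; rewrite invr_ge0.
rewrite expnS mul2n -addnn big_split_ord -natr1 mulrDl lerD//=.
rewrite -[leLHS](_ : \sum_(i < (2 ^ m)%N) (2 ^ m.+1)%N%:R^-1 = _).
  apply: ler_sum => i _; rewrite lef_pV2 ?posrE ?ltr0n ?expn_gt0// ler_nat.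
  by rewrite expnS mul2n -addnn -addnS leq_add2l.
have pow_neq0 : (2 ^ m)%N%:R != 0 :> F by rewrite pnatr_eq0 -lt0n expn_gt0.
by rewrite sumr_const card_ord -[LHS]mulr_natl expnS natrM invfM mulrCA mulfV ?mulr1 ?mul1r.
Qed.

(** The integers congruent to 1 modulo 2 h suffice: among those up to 2 ^ k are
    the 2 h i + 1 with i < 2 ^ (k - 2 h), because 2 h <= 2 ^ (2 h). *)
Lemma coprime_harmonic_ge k : (0 < h)%N -> (4 * h <= k)%N ->
  k%:R / (8 * h%:R) <= coprime_harmonic (2 ^ k).
Proof.
move=> h0 hk; pose m := (k - 2 * h)%N.
have km : k = (2 * h + m)%N by rewrite subnKC//; lia.
have bound (i : 'I_(2 ^ m)) : (2 * h * i + 1 < (2 ^ k).+1)%N.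
  have : (2 * h * i.+1 <= 2 ^ (2 * h) * 2 ^ m)%N by rewrite leq_mul// ltnW// ltn_expl.
  by rewrite ltnS km expnD; apply: leq_trans; rewrite mulnS; lia.
have h0' : 0 < h%:R :> F by rewrite ltr0n.
apply: le_trans (_ : (2 * h%:R)^-1 * (m%:R / 2) <= _).
  have -> : (2 * h%:R)^-1 * (m%:R / 2) = (2 * m%:R) / (8 * h%:R) :> F.
    by field; rewrite gt_eqF.
  by rewrite ler_wpM2r ?invr_ge0 ?mulr_ge0// -natrM ler_nat; lia.
apply: le_trans (ler_wpM2l _ (harmonic_pow2_ge m)) _; first by rewrite invr_ge0 mulr_ge0.
rewrite mulr_sumr.
apply: le_trans (ler_sum_inj (f := fun i => Ordinal (bound i)) (P := predT) _ _ _).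
- apply: ler_sum => i _; rewrite -invfM /= lef_pV2 ?posrE ?mulr_gt0 ?ltr0n ?addn1//.
  by rewrite -natrM -natrM ler_nat mulnS; lia.
- move=> i j _ _ [] /eqP; rewrite eqn_add2r eqn_pmul2l ?muln_gt0// => /eqP.
  exact: val_inj.
- by move=> i _ /=; rewrite /coprime mulnC gcdnC gcdnMDl gcdn1.
- by move=> a; rewrite invr_ge0.
Qed.

Lemma sieve_mass_ge k : (0 < h)%N -> (4 * h <= k)%N ->
  k%:R ^+ 2 / (512 * h%:R ^+ 2) <= sieve_mass F h (2 ^ (k * 2)).
Proof.
move=> h0 hk; have h0' : 0 < h%:R :> F by rewrite ltr0n.
have le1 := coprime_harmonic_ge h0 hk; have le2 := coprime_harmonic_sqr_le (2 ^ k).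
rewrite expnM -(ler_pM2l (_ : 0 < 8 :> F))//; apply: le_trans le2.
rewrite (_ : 8 * _ = (k%:R / (8 * h%:R)) ^+ 2); last by field; rewrite gt_eqF.
by rewrite lerXn2r// nnegrE ?divr_ge0 ?mulr_ge0// sumr_ge0// => a _; rewrite invr_ge0.
Qed.

End SieveMass.

(** * Counting primes *)

Definition prime_count N := count prime (iota 0 N.+1).

Lemma prime_countS N : prime_count N.+1 = (prime_count N + prime N.+1)%N.
Proof. by rewrite /prime_count -[in LHS]addn1 iotaD count_cat /= addn0. Qed.

Lemma prime_count_le N : (prime_count N <= N)%N.
Proof. by elim: N => // N IH; rewrite prime_countS -addn1 leq_add ?leq_b1. Qed.

(** By Legendre's formula, each power of p up to N contributes at most one
    factor p to the binomial coefficient. *)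
Lemma pfactor_bin_le p N i : prime p -> (0 < N)%N -> (i <= N)%N ->
  (p ^ logn p 'C(N, i) <= N)%N.
Proof.
move=> pr_p N0 iN; have p1 := prime_gt1 pr_p.
apply: leq_trans (trunc_logP p1 N0); rewrite leq_exp2l//; set t := trunc_log p N.
have tN : (t <= N)%N.
  exact/ltnW/(leq_trans (ltn_expl t p1))/trunc_logP.
have legendre j : (j <= N)%N -> logn p j`! = (\sum_(1 <= k < N.+1) j %/ p ^ k)%N.
  move=> jN; rewrite logn_fact// (big_nat_widen _ _ N.+1)// big_mkcond /=.
  rewrite big_nat_cond [RHS]big_nat_cond; apply: eq_bigr => k _.
  case: ifP => // /negbT; rewrite -leqNgt => jk; rewrite divn_small//.
  exact: ltn_trans jk (ltn_expl k p1).
have powers_le : (\sum_(1 <= k < N.+1) (p ^ k <= N) <= t)%N.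
  apply: (@leq_trans (\sum_(1 <= k < N.+1 | (k < t.+1)%N) 1)%N).
    rewrite [leqRHS]big_mkcond /=; apply: leq_sum => k _.
    by case: (leqP (p ^ k) N) => [pkN | //]; rewrite ltnS (trunc_log_max p1 pkN).
  by rewrite -(big_nat_widen 1 t.+1 N.+1 xpredT)// sum_nat_const_nat muln1 subn1.
have := congr1 (logn p) (bin_fact iN).
rewrite !lognM ?muln_gt0 ?bin_gt0 ?fact_gt0// !legendre ?leq_subr//.
set a := (\sum_(_ <= _ < _) i %/ _)%N; set b := (\sum_(_ <= _ < _) (N - i) %/ _)%N.
move=> eq_logn; rewrite -(leq_add2r (a + b)) eq_logn addnC.
apply: leq_trans (leq_add (leqnn _) powers_le); rewrite /a /b -!big_split /=.
apply: leq_sum => k _; have pk0 : (0 < p ^ k)%N by rewrite expn_gt0 (ltnW p1).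
rewrite -{1}(subnKC iN) divnD// leq_add2l.
case: (leqP (p ^ k) (_ + _)) => // carry; rewrite (leq_trans carry)//.
by rewrite -[leqRHS](subnKC iN) leq_add ?leq_mod.
Qed.

(** Each prime up to N contributes at most a factor N. *)
Lemma bin_le_exp_prime_count N i : (0 < N)%N -> (i <= N)%N ->
  ('C(N, i) <= N ^ prime_count N)%N.
Proof.
move=> N0 iN; have c0 : (0 < 'C(N, i))%N by rewrite bin_gt0.
apply: (@leq_trans (N ^ size (primes 'C(N, i)))%N).
  rewrite [leqLHS]prod_prime_decomp// prime_decompE big_map /=.
  rewrite -[X in (_ ^ X)%N]sum1_size expn_sum big_seq [leqRHS]big_seq.
  by apply: leq_prod => p; rewrite mem_primes => /andP[pr_p _]; rewrite pfactor_bin_le.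
rewrite leq_pexp2l// /prime_count -size_filter uniq_leq_size ?primes_uniq// => p p_c.
have pr_p : prime p by move: p_c; rewrite mem_primes => /andP[].
rewrite mem_filter pr_p mem_iota /= add0n ltnS.
apply: leq_trans (pfactor_bin_le pr_p N0 iN).
by rewrite -{1}[p]expn1 leq_exp2l ?prime_gt1// logn_gt0.
Qed.

(** For N = 2 ^ L, the power 2 ^ N is a sum of N + 1 binomial coefficients, each
    of them at most N ^ pi(N) = 2 ^ (L pi(N)). *)
Lemma chebyshev_lower L : (2 ^ L <= L * (prime_count (2 ^ L)).+1 + 1)%N.
Proof.
set c := prime_count _; have N0 : (0 < 2 ^ L)%N by rewrite expn_gt0.
rewrite -(@leq_exp2l 2)// mulnS -addnA [(_ + 1)%N]addnC addnA addn1.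
rewrite expnD expnM expnS -[X in (X ^ 2 ^ L)%N]/(1 + 1)%N expnDn.
apply: (@leq_trans (\sum_(i < (2 ^ L).+1) (2 ^ L) ^ c)%N).
  by apply: leq_sum => i _; rewrite !exp1n !muln1 bin_le_exp_prime_count// -ltnS.
by rewrite sum_nat_const card_ord leq_mul2r mul2n -addnn -ltn_subLR// subnn N0 orbT.
Qed.

(** * Prime pairs and skipped values *)

Lemma count_iotaE (A : pred nat) N : count A (iota 0 N) = #|[pred n : 'I_N | A n]|.
Proof. by rewrite -sum1_count -sum1_card -{1}[N]subn0 big_mkord. Qed.

Definition prime_pair h p := prime p && prime (p + h).

(** The sieve with N = 2 ^ (16 k) and z = 2 ^ (2 k), so that z^4 is only the
    square root of N. The pairs with n <= z, which the sieve does not see, are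
    counted trivially. The constant 1024 h^2 is twice that of [sieve_mass_ge], as
    N + 1 <= 2 N, and 3 accounts for z^4, z and 1, each at most N / k^2. *)
Lemma prime_pairs_le (F : realFieldType) h k : (0 < h)%N -> (4 * h <= k)%N ->
  (count (prime_pair h) (iota 0 (2 ^ (16 * k)).+1))%:R
    <= (1024 * h%:R ^+ 2 + 3) * (2 ^ (16 * k))%N%:R / k%:R ^+ 2 :> F.
Proof.
move=> h0 hk; have k0 : (0 < k)%N by lia.
pose N := (2 ^ (16 * k))%N; pose z := (2 ^ (k * 2))%N; rewrite -/N.
have z0 : (0 < z)%N by rewrite expn_gt0.
pose A n := (z < n)%N && prime_pair h n.
have A_sifted n p : A n -> prime p -> (p <= z)%N -> ~~ (p %| n * (n + h))%N.
  move=> /andP[zn /andP[pr_n pr_nh]] pr_p pz; rewrite Euclid_dvdM// !dvdn_prime2//.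
  apply/norP; split; apply: contraTneq pz => ->; rewrite -ltnNge//.
  by rewrite (leq_trans zn)// leq_addr.
have count_le : (count (prime_pair h) (iota 0 N.+1) <= count A (iota 0 N.+1) + z.+1)%N.
  rewrite (leq_trans (sub_count (a2 := predU A (fun n => n < z.+1)%N) _ _))//.
    by move=> n /= nP; rewrite /A nP andbT ltnS; case: leqP.
  rewrite (leq_trans (leq_addr (count (predI A (fun n => n < z.+1)%N) (iota 0 N.+1)) _))//.
  rewrite count_predUI leq_add2l -size_filter -[leqRHS](size_iota 0).
  by rewrite uniq_leq_size ?filter_uniq ?iota_uniq// => n; rewrite mem_filter !mem_iota => /andP[].
have sieve := @pair_sieve F h N.+1 z A z0 A_sifted; rewrite -count_iotaE in sieve.
have k0' : 0 < k%:R :> F by rewrite ltr0n.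
have h0' : 0 < h%:R :> F by rewrite ltr0n.
have mass := @sieve_mass_ge F h k h0 hk; rewrite -/z in mass.
have main : N.+1%:R / sieve_mass F h z <= 1024 * h%:R ^+ 2 * N%:R / k%:R ^+ 2 :> F.
  have c0 : 0 < k%:R ^+ 2 / (512 * h%:R ^+ 2) :> F.
    by rewrite divr_gt0 ?mulr_gt0 ?exprn_gt0 ?ltr0n.
  apply: (@le_trans _ _ ((2 * N)%N%:R / (k%:R ^+ 2 / (512 * h%:R ^+ 2)))).
    apply: ler_pM => //.
    - by rewrite invr_ge0 (le_trans (ltW c0)).
    - by rewrite ler_nat mul2n -addnn -addn1 leq_add2l expn_gt0.
    - by rewrite lef_pV2 ?posrE// (lt_le_trans c0).
  by rewrite natrM le_eqVlt; apply/orP; left; apply/eqP; field; rewrite !gt_eqF.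
have error : ((z ^ 4)%N%:R + z.+1%:R) <= 3 * N%:R / k%:R ^+ 2 :> F.
  rewrite ler_pdivlMr ?exprn_gt0// -natrX -natrD -!natrM ler_nat.
  have zz : (z <= z ^ 4)%N by rewrite -{1}[z]expn1 leq_pexp2l.
  apply: (@leq_trans ((3 * z ^ 4) * z ^ 4)); last first.
    by rewrite -mulnA -expnD /z -expnM /N (_ : k * 2 * (4 + 4) = 16 * k)%N//; lia.
  apply: leq_mul; first by lia.
  apply: leq_trans zz; rewrite /z expnM leq_exp2r// ltnW// ltn_expl//.
have : (count (prime_pair h) (iota 0 N.+1))%:R <= (count A (iota 0 N.+1))%:R + z.+1%:R :> F.
  by rewrite -natrD ler_nat.
rewrite [X in _ -> _ <= X](_ : _ = 1024 * h%:R ^+ 2 * N%:R / k%:R ^+ 2 + 3 * N%:R / k%:R ^+ 2).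
  by move=> le1; lra.
by field; rewrite gt_eqF.
Qed.

(** If m is skipped then no multiple of n lies in [p_m, p_(m+1)), so that this
    interval has length less than n. Here p is the least integer q with
    m <= pi(q), and h is the distance to a prime before p + n. *)
Lemma skipped_value n m N : (0 < n)%N -> (0 < m <= prime_count N)%N ->
  (forall k, (0 < k)%N -> prime_count (k * n) <> m) ->
  exists p h, [/\ (p <= N)%N, prime_count p = m, (0 < h < n)%N & prime_pair h p].
Proof.
move=> n0 /andP[m0 mN] skip.
have ex_p : exists q, (m <= prime_count q)%N by exists N.
have [p mp p_min] := ex_minnP ex_p.
have p0 : (0 < p)%N by rewrite lt0n; apply: contraTneq mp => ->; rewrite -ltnNge.
have [pr_p count_p] : prime p /\ prime_count p = m.
  have : ~~ (m <= prime_count p.-1)%N by apply/negP => /p_min; rewrite leqNgt prednK ?leqnn.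
  by move: mp; rewrite -(prednK p0) prime_countS /=; case: (prime _); lia.
have [/hasP[h] | /hasPn no_h] := boolP (has (fun h => prime (p + h)) (iota 1 n.-1)).
  rewrite mem_iota add1n prednK// => h_n pr_ph.
  by exists p, h; rewrite p_min// /prime_pair pr_p pr_ph.
have constant j : (j < n)%N -> prime_count (p + j) = m.
  elim: j => [|j IH] jn; first by rewrite addn0.
  rewrite addnS prime_countS IH ?(ltnW jn)// -addnS (negPf (no_h j.+1 _)) ?addn0//.
  by rewrite mem_iota add1n prednK.
pose k := ((p + n.-1) %/ n)%N.
have k_eq := divn_eq (p + n.-1) n; have k_mod := ltn_pmod (p + n.-1) n0.
rewrite -/k in k_eq.
case: (skip k); first by rewrite divn_gt0//; lia.
by rewrite (_ : k * n = p + (k * n - p))%N ?constant//; lia.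
Qed.

Lemma count_has_le (I J : Type) (P : I -> pred J) (r : seq I) (s : seq J) :
  (count (fun j => has (fun i => P i j) r) s <= \sum_(i <- r) count (P i) s)%N.
Proof.
elim: r => [|i r IH] /=; first by rewrite count_pred0.
rewrite big_cons -(leq_add2l (count (P i) s)) in IH *; apply: leq_trans IH.
rewrite -count_predUI; apply: leq_trans (leq_addr _ _).
by rewrite (eq_count (a2 := predU (P i) (fun j => has (fun i => P i j) r))).
Qed.

(** Each skipped m is pi(p) for a prime p at which some prime pair of difference
    less than n starts. *)
Lemma count_skipped_le n N (P : pred nat) : (0 < n)%N ->
  (forall m, P m -> forall k, (0 < k)%N -> prime_count (k * n) <> m) ->
  (count P (iota 1 (prime_count N))
    <= \sum_(h <- iota 1 n.-1) count (prime_pair h) (iota 0 N.+1))%N.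
Proof.
move=> n0 skip; apply: leq_trans (count_has_le _ _ _).
rewrite -!size_filter -[leqRHS](size_map prime_count); apply: uniq_leq_size.
  by rewrite filter_uniq ?iota_uniq.
move=> m; rewrite mem_filter mem_iota add1n ltnS => /andP[/skip m_skip m_N].
have [p [h [pN <- h_n pair]]] := skipped_value n0 m_N m_skip.
apply: map_f; rewrite mem_filter mem_iota add0n ltnS pN leq0n !andbT.
by apply/hasP; exists h => //; rewrite mem_iota add1n prednK.
Qed.

(** There are fewer than n differences h, and the bound on prime pairs grows with
    h, so that its value at n can be used for all of them. *)
Lemma skipped_count_bound (F : realFieldType) n (P : pred nat) :
  (0 < n)%N -> (forall m, P m -> forall j, (0 < j)%N -> prime_count (j * n) <> m) ->
  exists2 C : F, 0 <= C & forall k, (4 * n <= k)%N ->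
  (count P (iota 1 (prime_count (2 ^ (16 * k)))))%:R
    <= C * (2 ^ (16 * k))%N%:R / k%:R ^+ 2.
Proof.
move=> n0 skip; pose D : F := 1024 * n%:R ^+ 2 + 3.
have D0 : 0 <= D by rewrite addr_ge0 ?mulr_ge0 ?ler0n ?exprn_ge0 ?ler0n.
exists (n%:R * D); first by rewrite mulr_ge0.
move=> k nk; pose N := (2 ^ (16 * k))%N.
apply: (@le_trans _ _ (\sum_(h <- iota 1 n.-1) (count (prime_pair h) (iota 0 N.+1))%:R)).
  by rewrite -natr_sum ler_nat count_skipped_le.
pose b : F := D * N%:R / k%:R ^+ 2.
have b0 : 0 <= b by rewrite divr_ge0 ?exprn_ge0 ?mulr_ge0.
apply: (@le_trans _ _ (\sum_(h <- iota 1 n.-1) b)).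
  rewrite big_seq [leRHS]big_seq; apply: ler_sum => h.
  rewrite mem_iota add1n prednK// => /andP[h0 hn].
  apply: le_trans (prime_pairs_le F h0 _) _; first by lia.
  rewrite /b -!mulrA ler_wpM2r ?mulr_ge0 ?invr_ge0 ?exprn_ge0//.
  by rewrite lerD2r ler_pM2l ?ltr0n// lerXn2r ?nnegrE// ler_nat ltnW.
rewrite big_const_seq count_predT size_iota iter_addr_0 -[leLHS]mulr_natl.
rewrite (_ : _ / _ = n%:R * b); last by rewrite /b !mulrA.
by rewrite ler_wpM2r// ler_nat leq_pred.
Qed.

(** * Counting functions of a real variable *)

Local Open Scope classical_set_scope.

Lemma primepi_nat (R : realType) (m : nat) : primepi (m%:R : R) = prime_count m.
Proof.
rewrite /primepi /count_upto.
have -> : fset_set (upto [set p | prime p] (m%:R : R))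
          = seq_fset tt [seq p <- iota 0 m.+1 | prime p].
  apply/fsetP => p; rewrite in_fset_set; last exact: finite_upto.
  rewrite seq_fsetE mem_filter mem_iota /= ltnS.
  by apply/idP/andP => [/set_mem[/= -> ] | [pr_p pm]]; rewrite ?inE /upto /= ?ler_nat.
by rewrite size_seq_fset undup_id ?filter_uniq ?iota_uniq// size_filter.
Qed.

Lemma count_upto_le (R : realType) (S B : set nat) (P : pred nat) (x : nat) :
  S `<=` Zplus -> finite_set B -> (forall m, S m -> B m \/ P m) ->
  (count_upto S (x%:R : R) <= #|` fset_set B|%fset + count P (iota 1 x))%N.
Proof.
move=> S_pos B_fin SBP; rewrite -size_filter.
have sub : (fset_set (upto S (x%:R : R)) `<=`
            fset_set B `|` seq_fset tt [seq m <- iota 1 x | P m])%fset.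
  apply/fsubsetP => m; rewrite in_fset_set; last exact: finite_upto.
  move=> /set_mem[Sm]; rewrite ler_nat => mx; rewrite inE in_fset_set// seq_fsetE.
  case: (SBP m Sm) => [Bm | Pm]; first by rewrite (mem_set Bm).
  by rewrite mem_filter Pm mem_iota (S_pos m Sm) add1n ltnS mx orbT.
apply: leq_trans (fsubset_leq_card sub) _; rewrite cardfsU (leq_trans (leq_subr _ _))//.
by rewrite leq_add2l size_seq_fset undup_id ?filter_uniq ?iota_uniq.
Qed.

(** Since ln x <= 16 k for x = pi(2 ^ (16 k)), this is Chebyshev's lower bound
    for x divided by 16 k. *)
Lemma prime_count_div_ln_ge (R : realType) k : (1 < k)%N ->
  let x : R := (prime_count (2 ^ (16 * k)))%:R in
  (2 ^ (16 * k))%N%:R / (512 * k%:R ^+ 2) <= x / ln x /\ k%:R < x.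
Proof.
move=> k1; set N := (2 ^ (16 * k))%N; set c := prime_count N => x.
have k0 : 0 < k%:R :> R by rewrite ltr0n ltnW.
have N_lb : (k ^ 2 * 128 <= N)%N.
  have -> : N = ((2 ^ k) ^ 2 * 2 ^ (14 * k))%N.
    by rewrite -expnM -expnD /N; congr (2 ^ _)%N; lia.
  apply: leq_mul; first by rewrite leq_exp2r// ltnW// ltn_expl.
  by rewrite -[128%N]/(2 ^ 7)%N leq_exp2l//; lia.
have c_lb : (N <= 32 * k * c)%N by have := chebyshev_lower (16 * k); rewrite -/N -/c; nia.
have kc : (k < c)%N by nia.
have x1 : 1 < x by rewrite ltr1n; lia.
have ln_pos : 0 < ln x by rewrite ln_gt0.
have ln_le : ln x <= 16 * k%:R.
  have xN : x <= N%:R by rewrite ler_nat prime_count_le.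
  apply: (@le_trans _ _ (ln N%:R)).
    by rewrite ler_ln ?posrE// ?(lt_trans _ x1)// (lt_le_trans _ xN)// (lt_trans _ x1).
  rewrite /N natrX lnXn// -[leLHS]mulr_natl natrM ler_piMr// -[2]/(1 + 1 : R).
  by apply: le_ln1Dx; rewrite ltrN10 || lra.
split; last by rewrite ltr_nat.
apply: (@le_trans _ _ (x / (16 * k%:R))).
  rewrite ler_pdivrMr ?mulr_gt0 ?exprn_gt0 ?ltr0n ?(ltnW k1)// mulrAC ler_pdivlMr ?mulr_gt0//.
  move: c_lb; rewrite -(ler_nat R) !natrM -/x; nra.
by rewrite ler_pM2l ?(lt_trans _ x1)// lef_pV2// posrE mulr_gt0.
Qed.

Theorem theorem1p1 (R : realType) (S : set nat)
    (S_pos : S `<=` Zplus)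
    (S_dense : (count_upto S x)%:R / (x / ln x) @[x --> (+oo : set_system R)]
                 --> (+oo : set_system R))
    (n : nat) (n_pos : Zplus n) :
  infinite_set (primepi_multiples R n `&` S).
Proof.
set B := _ `&` S => B_fin.
pose P m := ~~ `[< primepi_multiples R n m >].
have SBP m : S m -> B m \/ P m.
  by move=> Sm; rewrite /P; case: asboolP => Am; [left | right].
have P_skip m : P m -> forall j, (0 < j)%N -> prime_count (j * n) <> m.
  by move=> /asboolPn Am j j0 jm; apply: Am; exists j => //; rewrite primepi_nat.
pose T := #|` fset_set B|%fset.
have [C C0 skip_bound] := skipped_count_bound R n_pos P_skip.
(* The factor 512 is the one lost between N / k^2 and x / ln x. *)
have /cvgryPge/(_ (512 * (C + 1))) [M [_ dense]] := S_dense.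
(* Large enough for the bounds on skipped values, for k to exceed the threshold
   M and for N / k^2 to exceed the number T of elements of B. *)
pose k := (4 * n + T + Num.truncn `|M| + 2)%N.
have k1 : (1 < k)%N by rewrite /k; lia.
have nk : (4 * n <= k)%N by rewrite /k; lia.
have [] := prime_count_div_ln_ge R k1; set N := (2 ^ (16 * k))%N.
set c := prime_count N => x_ge k_c.
have Mk : M < k%:R.
  rewrite (le_lt_trans (ler_norm M))// (lt_le_trans (truncnS_gt _))// ler_nat /k addn2 ltnS.
  by rewrite leqW// leq_addl.
have := dense _ (lt_trans Mk k_c).
have count_le := @count_upto_le R S B P c S_pos B_fin SBP.
have skip_le := skip_bound k nk; rewrite -/N -/c in skip_le.
have k0 : 0 < k%:R :> R by rewrite ltr0n; lia.
have T_lt : T%:R < N%:R / k%:R ^+ 2 :> R.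
  rewrite ltr_pdivlMr ?exprn_gt0// -natrX -natrM ltr_nat.
  have -> : N = (2 ^ (14 * k) * (2 ^ k) ^ 2)%N.
    by rewrite -expnM -expnD /N; congr (2 ^ _)%N; lia.
  apply: ltn_mul; last by rewrite ltn_exp2r// ltn_expl.
  by apply: (@leq_ltn_trans (14 * k)%N); [rewrite /k; lia | rewrite ltn_expl].
set x : R := c%:R; rewrite -/x in x_ge k_c *.
have N0 : 0 < N%:R / (512 * k%:R ^+ 2) :> R.
  by rewrite divr_gt0 ?mulr_gt0 ?exprn_gt0 ?ltr0n ?expn_gt0 ?(ltnW k1).
have y0 : 0 < x / ln x := lt_le_trans N0 x_ge.
rewrite ler_pdivlMr//; apply/negP; rewrite -ltNge.
have : (count_upto S x)%:R <= T%:R + C * N%:R / k%:R ^+ 2 :> R.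
  by rewrite (le_trans _ (lerD (lexx _) skip_le))// -natrD ler_nat.
have -> : C * N%:R / k%:R ^+ 2 = C * (N%:R / k%:R ^+ 2) by rewrite mulrA.
move/le_lt_trans; apply.
have K0 : 0 <= 512 * (C + 1) :> R by rewrite mulr_ge0 ?ler0n ?addr_ge0 ?ler01.
apply: lt_le_trans (ler_wpM2l K0 x_ge).
rewrite [ltRHS](_ : _ = (C + 1) * (N%:R / k%:R ^+ 2)); last by field; rewrite gt_eqF.
by rewrite mulrDl mul1r addrC ltrD2l.
Qed.
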